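(* Let $w\in A^*$ be a Nyldon word. For each Nyldon proper suffix $s$ of $w$ (i.e. each Nyldon word $s\neq w$ that is a suffix of $w$), we have $s<_{\mathrm{lex}}w$.
   Context: $A$ is a finite alphabet of cardinality at least $2$ with a total order $<$. $A^*$ is the set of finite words over $A$ (including the empty word $\varepsilon$), $|w|$ is the length of $w$. The lexicographic order $<_{\mathrm{lex}}$ on $A^*$ is the total order given by: $u<_{\mathrm{lex}}v$ if $u$ is a proper prefix of $v$, or there exist letters $i<j$ and a word $p$ such that $pi$ is a prefix of $u$ and $pj$ is a prefix of $v$; $u\le_{\mathrm{lex}}v$ means $u<_{\mathrm{lex}}v$ or $u=v$. Nyldon words are defined recursively on length: every letter (word of length $1$) is Nyldon; a word $w$ of length at least $2$ is Nyldon if and only if there is no sequence $(n_1,\ldots,n_k)$ of Nyldon words with $w=n_1\cdots n_k$, $\max\{|n_1|,\ldots,|n_k|\}<|w|$ and $n_1\le_{\mathrm{lex}}\cdots\le_{\mathrm{lex}}n_k$. The empty word is not Nyldon. *)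

(* Defs.v *)
From mathcomp Require Import all_boot all_order.

Set Implicit Arguments.
Unset Strict Implicit.
Unset Printing Implicit Defensive.

Import Order.TTheory.

(* A plain [seq A] carries no order until a default is imported, hence the
   casts to [seqlexi A]. *)
Definition lelex (d : Order.disp_t) (A : orderType d) : rel (seq A) :=
  fun u v => ((u : seqlexi A) <= (v : seqlexi A))%O.

Definition ltlex (d : Order.disp_t) (A : orderType d) : rel (seq A) :=
  fun u v => ((u : seqlexi A) < (v : seqlexi A))%O.

Lemma ltlexP (d : Order.disp_t) (A : orderType d) (u v : seq A) :
  ltlex u v <->
  (prefix u v /\ u <> v) \/
  (exists i j p, [/\ (i < j)%O, prefix (rcons p i) u & prefix (rcons p j) v]).
Proof.
rewrite /ltlex; elim: u v => [|x u IH] [|y v] /=.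
- by split=> // -[[_ []] // | [i [j [[|? ?] []]]]].
- by split=> // _; left.
- rewrite ltxis0; split=> // -[[] // | [i [j [[|z p] [_ _]]]]] //.
rewrite ltxi_cons; split.
- case/andP=> lexy; have [leyx|ltxy] /= := leP y x.
    have <-: x = y by apply/le_anti; rewrite lexy.
    case/IH=> [[uv neq]|[i [j [p [ij pu pv]]]]].
      by left; rewrite eqxx; split=> // -[].
    by right; exists i, j, (x :: p); rewrite /= !eqxx.
  by move=> _; right; exists x, y, [::]; rewrite /= !eqxx !prefix0s.
- case=> [[/andP[/eqP <- uv] neq]|[i [j [[|z p] [ij]]]]] /=.
  + rewrite !lexx /=; apply/IH; left; split=> // e; by apply: neq; rewrite e.
  + move=> /andP[/eqP <- _] /andP[/eqP <- _].
    by rewrite (ltW ij) leNgt ij.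
  + move=> /andP[/eqP <- pu] /andP[/eqP <- pv]; rewrite !lexx /=.
    by apply/IH; right; exists i, j, p.
Qed.

(* Structural recursion on a bound [n] for the length of [w]; by [nyldon_upto_eq]
   the bound is immaterial once it is at least [size w]. *)
Fixpoint nyldon_upto (d : Order.disp_t) (A : orderType d)
    (n : nat) (w : seq A) : Prop :=
  if n is m.+1 then
    size w = 1 \/
    (2 <= size w /\
     ~ exists ns : seq (seq A),
         [/\ w = flatten ns,
             forall v, v \in ns -> size v < size w /\ nyldon_upto m v
           & sorted (@lelex d A) ns])
  else False.

Definition nyldon (d : Order.disp_t) (A : orderType d) (w : seq A) : Prop :=
  nyldon_upto (size w) w.

Lemma nyldon_upto_eq (d : Order.disp_t) (A : orderType d) m n (w : seq A) :
  size w <= m -> size w <= n -> nyldon_upto m w <-> nyldon_upto n w.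
Proof.
have nil k : ~ nyldon_upto k ([::] : seq A) by case: k => [|k] //= [|[]].
elim: m n w => [|m IH] [|n] [|x w] // wm wn;
  try by split=> /nil.
have key (v : seq A) :
    size v < size (x :: w) -> nyldon_upto m v <-> nyldon_upto n v.
  by move=> vw; apply: IH; rewrite -ltnS; apply: leq_trans vw _.
move: key; set u := x :: w => key /=.
by split=> -[|[w2 H]]; [left | right | left | right];
  rewrite // ; split=> // -[ns [e f st]]; apply: H; exists ns; split=> //;
  move=> v /f [vw nv]; split=> //; apply/key.
Qed.

Lemma nyldonE (d : Order.disp_t) (A : orderType d) (w : seq A) :
  nyldon w <->
  size w = 1 \/
  (2 <= size w /\
   ~ exists ns : seq (seq A),
       [/\ w = flatten ns,
           forall v, v \in ns -> size v < size w /\ nyldon v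
         & sorted (@lelex d A) ns]).
Proof.
have key (v : seq A) : size v < size w -> nyldon_upto (size w) v <-> nyldon v.
  by move=> vw; apply: nyldon_upto_eq => //; apply: ltnW.
have wS : nyldon w <-> nyldon_upto (size w).+1 w by apply: nyldon_upto_eq.
apply: (iff_trans wS).
rewrite /=; split=> -[|[w2 H]]; [by left | right | by left | right];
  split=> // -[ns [e f st]]; apply: H; exists ns; split=> //;
  by move=> v /f [vw nv]; split=> //; apply/key.
Qed.

(* Main.v *)
Require Import Defs.
From Stdlib Require Import Classical_Prop.
From mathcomp Require Import all_boot all_order.

(** Call a nondecreasing sequence of Nyldon words a Nyldon factorization of its
    concatenation. Every word has one ([nyldon_fact_exists]), and a Nyldon word
    has only the one-term factorization ([nyldon_factE]).

    The theorem is proved by induction on [size w]. What makes the induction run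
    is that the last factor of a factorization absorbs every Nyldon suffix
    ([nyldon_suffix_last]), as long as the theorem is known for the factors
    themselves: a suffix starting inside an earlier factor [m] cuts off a tail
    of [m], the factors of that tail end with a Nyldon suffix of [m], which is
    at most [m] and hence at most the next factor, so the whole suffix would
    inherit a factorization with at least two terms.

    Now let [w = p ++ s] with [s] Nyldon and [p] nonempty, and let [m] be the
    last factor of [p]. Since [w] is Nyldon, [s < m]. If [m = p], then
    [s < p <= w], because [p] is a prefix of [w]. Otherwise [m ++ s] is shorter
    than [w]; the last factor of [m ++ s] has [s] as a suffix and cannot be [s]
    itself, for then the remaining factors would factor [m], which would make
    [m] the factor before [s], against [s < m]. So this last factor is a Nyldon
    suffix of [w] strictly between [s] and [w] in length; it is larger than [s]
    by induction on [size w], and at most [w] by a second induction, on the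
    length of the prefix that is left. *)

Set Implicit Arguments.
Unset Strict Implicit.
Unset Printing Implicit Defensive.

Import Order.TTheory.

Lemma cat_eq_cat (T : eqType) (a b c e : seq T) :
  a ++ b = c ++ e -> size a <= size c -> exists2 x, c = a ++ x & b = x ++ e.
Proof.
move=> E le_ac; have /prefixP[x Ex] : prefix a c.
  rewrite prefixE; apply/eqP; have := congr1 (take (size a)) E.
  by rewrite take_size_cat // takel_cat.
exists x => //; move/eqP: E.
by rewrite Ex -catA eqseq_cat // eqxx => /eqP.
Qed.

Section Nyldon.

Context (d : Order.disp_t) (A : orderType d).
Implicit Types (u v w s m p q : seq A) (ms ns : seq (seq A)).

Lemma lelex_trans : transitive (@lelex d A).
Proof. by move=> v u w; apply: le_trans. Qed.

Lemma lelex_refl : reflexive (@lelex d A).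
Proof. by move=> u; apply: lexx. Qed.

Lemma lelex_total : total (@lelex d A).
Proof. by move=> u v; apply: le_total. Qed.

Lemma prefix_lelex u v : prefix u v -> lelex u v.
Proof.
move=> uv; case: (eqVneq u v) => [->|/eqP neq]; first exact: lelex_refl.
by apply: ltW; apply/ltlexP; left.
Qed.

Definition nyldon_fact ns :=
  (forall v, v \in ns -> nyldon v) /\ sorted (@lelex d A) ns.

Lemma nyldon_size_gt0 w : nyldon w -> 0 < size w.
Proof. by move/nyldonE=> [->|[/ltnW]]. Qed.

Lemma size_le_flatten ns :
  (forall v, v \in ns -> nyldon v) -> size ns <= size (flatten ns).
Proof.
elim: ns => //= v ns IH nyl; rewrite size_cat -add1n leq_add //.
  by apply/nyldon_size_gt0/nyl/mem_head.
by apply: IH => u uns; apply: nyl; rewrite inE uns orbT.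
Qed.

(** Nyldon words are nonempty, so in a factorization with at least two terms
    every term is shorter than the product: the length condition in the
    definition of Nyldon words only excludes one-term factorizations. *)
Lemma nyldon_factE w ns :
  nyldon w -> nyldon_fact ns -> w = flatten ns -> ns = [:: w].
Proof.
move=> nw [nyl srt] E; have := nyldon_size_gt0 nw.
case: (leqP (size ns) 1) => [|ns2].
  by case: ns E {nyl srt} => [|v []] // ->; rewrite /= ?cats0.
have := size_le_flatten nyl; rewrite -E => le_w _.
case/nyldonE: nw => [w1|[_ []]]; first by move: (leq_trans ns2 le_w); rewrite w1.
exists ns; split=> // v vns; split; last exact: nyl.
case/splitPr: vns ns2 nyl E {srt le_w} => a b.
rewrite size_cat /= addnS ltnS => ab nyl ->.
have Ha : size a <= size (flatten a).
  by apply: size_le_flatten => u ua; apply: nyl; rewrite mem_cat ua.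
have Hb : size b <= size (flatten b).
  by apply: size_le_flatten => u ub; apply: nyl; rewrite mem_cat inE ub !orbT.
rewrite flatten_cat /= !size_cat addnCA -[X in X < _]addn0 ltn_add2l.
by apply: leq_trans ab _; apply: leq_add.
Qed.

Lemma nyldon_fact_exists w : exists2 ns, nyldon_fact ns & w = flatten ns.
Proof.
have one : nyldon w -> exists2 ns, nyldon_fact ns & w = flatten ns.
  move=> nw; exists [:: w]; last by rewrite /= cats0.
  by split=> // v; rewrite inE => /eqP->.
case: (leqP (size w) 1) => [|w2].
  case: w one => [|x []] // one _; first by exists [::].
  by apply: one; apply/nyldonE; left.
case: (classic (nyldon w)) => // nnw.
apply: NNPP => nex; apply: nnw; apply/nyldonE; right; split=> // -[ns [E f srt]].
by apply: nex; exists ns => //; split=> // v /f[].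
Qed.

Lemma nyldon_fact_rcons_exists w : 0 < size w ->
  exists ns m, nyldon_fact (rcons ns m) /\ w = flatten (rcons ns m).
Proof.
move=> w_gt0; have [ns + E] := nyldon_fact_exists w.
case/lastP: ns E => [E|ns m E fact]; first by rewrite E in w_gt0.
by exists ns, m.
Qed.

Lemma nyldon_fact_cat ms m n ns :
  nyldon_fact (rcons ms m) -> nyldon_fact (n :: ns) -> lelex m n ->
  nyldon_fact (rcons ms m ++ n :: ns).
Proof.
move=> [nyl1 srt1] [nyl2 srt2] mn; split=> [v|].
  by rewrite mem_cat => /orP[/nyl1|/nyl2].
by rewrite cat_rcons sorted_cat_cons srt1 /= mn.
Qed.

Lemma nyldon_fact_behead m ns : nyldon_fact (m :: ns) -> nyldon_fact ns.
Proof.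
move=> [nyl srt]; split; last exact: path_sorted srt.
by move=> v vns; apply: nyl; rewrite inE vns orbT.
Qed.

Lemma nyldon_fact_belast ns m : nyldon_fact (rcons ns m) -> nyldon_fact ns.
Proof.
move=> [nyl srt]; split; last by move: srt; rewrite -cats1 => /cat_sorted2[].
by move=> v vns; apply: nyl; rewrite mem_rcons inE vns orbT.
Qed.

(** The last factor absorbs every Nyldon suffix. A Nyldon suffix starting
    strictly before the last factor would be a nonempty tail of some factor [m]
    followed by the later factors, and the last Nyldon factor of that tail is a
    suffix of [m], hence at most [m], hence at most the next factor. *)
Lemma nyldon_suffix_last ms q s :
  (forall m, m \in ms -> forall t, nyldon t -> suffix t m -> lelex t m) ->
  nyldon_fact ms -> nyldon s -> flatten ms = q ++ s ->
  exists ns m, ms = rcons ns m /\ suffix s m.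
Proof.
move=> + + ns; elim: ms q => [|m ms IH] q suf fact /= E.
  by move: (nyldon_size_gt0 ns); case: q s E {ns} => [|? ?] [].
have suf' m' : m' \in ms -> forall t, nyldon t -> suffix t m' -> lelex t m'.
  by move=> m'ms; apply: suf; rewrite inE m'ms orbT.
case: (leqP (size m) (size q)) => [le_mq|lt_qm].
  have [q' _ E'] := cat_eq_cat E le_mq.
  have [rs [n [-> sn]]] := IH q' suf' (nyldon_fact_behead fact) E'.
  by exists (m :: rs), n.
have [m' Em Es] := cat_eq_cat (esym E) (ltnW lt_qm).
case: ms fact Es {IH E suf'} suf => [|m2 ms] fact Es suf.
  by exists [::], m; split=> //; rewrite Es cats0 Em suffix_suffix.
have m'_gt0 : 0 < size m' by move: lt_qm; rewrite Em size_cat -ltn_subLR ?subnn.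
have [ts [t [tfact Et]]] := nyldon_fact_rcons_exists m'_gt0.
have le_tm : lelex t m.
  apply: suf (mem_head _ _) _ _ _; first by apply: tfact.1; rewrite mem_rcons mem_head.
  by rewrite Em Et flatten_rcons catA suffix_suffix.
have le_mm2 : lelex m m2 by case: fact => _ /= /andP[].
have := nyldon_fact_cat tfact (nyldon_fact_behead fact) (lelex_trans le_tm le_mm2).
move/(nyldon_factE ns); rewrite flatten_cat -Et => /(_ Es) /(congr1 size).
by rewrite size_cat size_rcons /= addnS.
Qed.

(** The theorem in non-strict form: allowing [s = w] lets the induction
    hypothesis be used on a factor and a suffix that may be the whole factor. *)
Lemma nyldon_suffix_lelex w s : nyldon w -> nyldon s -> suffix s w -> lelex s w.
Proof.
move: {2}(size w) (leqnn (size w)) => n.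
elim: n w s => [|n IHw] w s; first by rewrite leqn0 => + /nyldon_size_gt0; case: size.
move=> size_w nw + /suffixP[p Ew].
elim: {p}(size p).+1 {-2}p (ltnSn (size p)) s Ew => // k IHp p size_p s Ew ns.
case: (posnP (size p)) => [/eqP/nilP p0|p_gt0].
  by rewrite Ew p0; apply: lelex_refl.
have [ps [m [pfact Ep]]] := nyldon_fact_rcons_exists p_gt0.
have nm : nyldon m by apply: pfact.1; rewrite mem_rcons mem_head.
have sfact : nyldon_fact [:: s] by split=> // v; rewrite inE => /eqP->.
have nle_ms : ~ lelex m s.
  move/(nyldon_fact_cat pfact sfact)/(nyldon_factE nw).
  rewrite flatten_cat -Ep /= cats0 => /(_ Ew) /(congr1 size).
  by rewrite size_cat size_rcons /= addnS.
have le_sm : lelex s m by case/orP: (lelex_total s m).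
(* If [p] is a single Nyldon word, [m ++ s] is [w] itself, too long for [IHw]. *)
case: (posnP (size ps)) => [/eqP/nilP ps0|ps_gt0].
  apply: lelex_trans le_sm _; apply: prefix_lelex.
  by rewrite Ew Ep ps0 /= cats0 prefix_prefix.
have Ep' : p = flatten ps ++ m by rewrite Ep flatten_rcons.
have lt_mp : size m < size p.
  rewrite Ep' size_cat -[X in X < _]add0n ltn_add2r.
  by apply: leq_trans ps_gt0 (size_le_flatten (nyldon_fact_belast pfact).1).
have [ms mfact Ems] := nyldon_fact_exists (m ++ s).
have sufP v : v \in ms -> forall t, nyldon t -> suffix t v -> lelex t v.
  move=> vms t nt; apply: IHw => //; last exact: mfact.1.
  rewrite -ltnS; apply: leq_trans size_w.
  apply: (@leq_ltn_trans (size (m ++ s))).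
    by case/splitPr: vms Ems => a b ->; rewrite flatten_cat /= !size_cat addnCA leq_addr.
  by rewrite Ew !size_cat ltn_add2r.
(* The last factor [r = x ++ s] of [m ++ s] is the intermediate suffix. *)
have [rs [r [Er /suffixP[x Ex]]]] := nyldon_suffix_last sufP mfact ns (esym Ems).
have nr : nyldon r by apply: mfact.1; rewrite Er mem_rcons mem_head.
have le_sr : lelex s r.
  by apply: sufP ns _; rewrite ?Er ?mem_rcons ?mem_head // Ex suffix_suffix.
have Em : m = flatten rs ++ x.
  move: Ems; rewrite Er flatten_rcons Ex catA => Ems.
  have := congr1 size Ems; rewrite size_cat [RHS]size_cat => /addIn sz.
  by move/eqP: Ems; rewrite eqseq_cat // => /andP[/eqP].
case: (posnP (size x)) => [/eqP/nilP x0|x_gt0].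
  case: nle_ms; move: Em mfact Er; rewrite x0 cats0 => Em mfact Er.
  rewrite Er in mfact; have := nyldon_factE nm (nyldon_fact_belast mfact) Em.
  by move=> Ers; move: mfact.2; rewrite Ers Ex x0 /= andbT.
apply: lelex_trans le_sr _.
apply: (IHp (flatten ps ++ flatten rs)) => //.
  rewrite ltnS in size_p; apply: leq_trans size_p.
  by rewrite Ep' Em !size_cat addnA -[X in X < _]addn0 ltn_add2l.
by rewrite Ew Ep' Em Ex !catA.
Qed.

End Nyldon.

Theorem theorem13 (d : Order.disp_t) (A : finOrderType d) (hA : 2 <= #|A|)
  (w : seq A) (hw : nyldon w) (s : seq A) (hs : nyldon s)
  (hsw : suffix s w) (hne : s <> w) :
  ltlex s w.
Proof.
rewrite /ltlex lt_neqAle; apply/andP; split; first exact/eqP.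
exact: nyldon_suffix_lelex.
Qed.
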